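(* Let $p\ge 17$ be prime, $k\ge 1$, $A,B\in\mathbb{N}$, $\bar A=A\bmod p$, $\bar B=B\bmod p$. For $j\ge1$ let $N_j$ be the number of pairs $(x,y)\in\mathbb{F}_{p^j}^2$ with $y^2=x^3+\bar Ax+\bar B$, and put $a_p=p-N_1$. Define the integer sequence $s_0=2$, $s_1=a_p$, $s_j=a_p\,s_{j-1}-p\,s_{j-2}$ for $j\ge 2$. (i) If $4\bar A^3+27\bar B^2\not\equiv 0\pmod p$, then $N_k=p^k-s_k$, and $|s_k|\le 2p^{k/2}$. (ii) If $4\bar A^3+27\bar B^2\equiv 0\pmod p$, then $N_k=p^k-a_p^{\,k}$, where $a_p\in\{0,\pm1\}$.
   Context: $\mathbb{N}$ includes $0$; $a\bmod p$ is the least nonnegative residue. $\mathbb{F}_{p^j}$ is the finite field with $p^j$ elements. *)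

(* Defs.v *)
From mathcomp Require Import all_boot all_order all_algebra.
Set Implicit Arguments.
Unset Strict Implicit.
Unset Printing Implicit Defensive.
Import GRing.Theory.
Local Open Scope ring_scope.

(* Affine solutions of y^2 = x^3 + a x + b, with z = (x, y); the point at
   infinity is not counted. *)
Definition affine_count (F : finFieldType) (a b : nat) : nat :=
  #|[set z : F * F | z.2 ^+ 2 == z.1 ^+ 3 + a%:R * z.1 + b%:R]|.

Fixpoint trace_seq (a q : int) (j : nat) : int :=
  match j with
  | 0 => 2
  | 1 => a
  | (j''.+1 as j').+1 => a * trace_seq a q j' - q * trace_seq a q j''
  end.

(* Main.v *)
From HB Require Import structures.
Require Import Defs.
From mathcomp Require Import all_boot all_order all_algebra all_field.
From mathcomp Require Import reals exp.
From mathcomp Require Import ring zify.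
Set Implicit Arguments.
Unset Strict Implicit.
Unset Printing Implicit Defensive.
Import Order.TTheory GRing.Theory Num.Theory.
Local Open Scope ring_scope.

(** Let [f = x^3 + a x + b] over [F_p] and let [S_i] be the sum of the
    quadratic character of [F_(p^i)] over the values of [f], so that [N_i = p^i + S_i].

    For a monic polynomial [h] let [chi h] be the quadratic character of the product of the values
    of [f] at the roots of [h], and let [c_n] be the sum of [chi] over the monic [h] of degree [n].
    Unique factorization gives [n c_n = sum_(1 <= i <= n) S_i c_(n-i)].  A sign-reversing
    permutation shows that [c_n = 0] for [n >= 3], and if the discriminant is nonzero then a direct
    computation gives [c_2 = p].  Hence [- S_i] satisfies the recurrence defining [s_i].

    Over [F_(p^(2m))] Bombieri's variant of Stepanov's method gives [|S_(2m)| <= 6 p^m] for all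
    [m], and the doubling formula [s_(2j) = s_j^2 - 2 p^j] turns this into [s_k^2 <= 4 p^k].

    If the discriminant vanishes then [f = (x - al)^2 (x + 2 al)] and [S_i] is minus the quadratic
    character of [3 al]. *)

(** * Quadratic characters of finite fields *)

(** Euler's criterion serves as the definition, so multiplicativity and the behaviour under norms
    become identities between powers; the link with square roots is [card_sqrt]. *)
Definition quad_char (K : finFieldType) (y : K) : int :=
  if y == 0 then 0 else if y ^+ #|K|./2 == 1 then 1 else -1.

Section QuadraticCharacter.
Variable K : finFieldType.
Hypothesis oddK : odd #|K|.
Local Notation eta := (@quad_char K).

Lemma card_gt2 : (2 < #|K|)%N.
Proof. by have := finNzRing_gt1 K; case: #|K| oddK => [|[|[|?]]]. Qed.

Lemma two_neq0 : (2%:R : K) != 0.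
Proof.
apply/eqP => two0; have char2 : 2 \in [pchar K] by rewrite inE /= two0 eqxx.
move: (oddK) (card_gt2); rewrite (card_pprimeChar char2) oddX orbF.
by move/eqP->.
Qed.

Lemma card_half : #|K| = (#|K|./2).*2.+1.
Proof. by rewrite -[LHS]odd_double_half oddK. Qed.

Lemma half_gt0 : (0 < #|K|./2)%N.
Proof. by have := card_gt2; rewrite [X in (_ < X)%N]card_half; case: _./2. Qed.

Lemma expf_half_sqr (y : K) : y != 0 -> (y ^+ #|K|./2) ^+ 2 = 1.
Proof.
move=> y0; rewrite -exprM muln2; apply: (mulfI y0).
by rewrite -exprS -card_half expf_card mulr1.
Qed.

Lemma quad_char_cases (y : K) : [\/ eta y = 0, eta y = 1 | eta y = -1].
Proof.
rewrite /quad_char; case: ifP => _; first by constructor 1.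
by case: ifP => _; [constructor 2|constructor 3].
Qed.

Lemma quad_char_euler (y : K) : (eta y)%:~R = y ^+ #|K|./2.
Proof.
rewrite /quad_char; have [->|y0] := eqVneq y 0.
  by rewrite expr0n eqn0Ngt half_gt0.
case: eqP => [->//|y1]; have := expf_half_sqr y0.
by move/eqP; rewrite sqrf_eq1 => /orP[/eqP//|/eqP->].
Qed.

Lemma one_neqN1 : (1 : K) != -1.
Proof. by rewrite -subr_eq0 opprK -mulr2n; exact: two_neq0. Qed.

(** In odd characteristic 0, 1 and -1 stay distinct in [K], so an identity between signs can be
    checked after mapping to [K]. *)
Lemma quad_char_unique (y : K) (e : int) :
  [\/ e = 0, e = 1 | e = -1] -> e%:~R = y ^+ #|K|./2 -> eta y = e.
Proof.
rewrite -quad_char_euler => He.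
have N10 : (-1 : K) <> 0 by apply/eqP; rewrite oppr_eq0 oner_eq0.
have N11 := elimN eqP one_neqN1; have o0 := elimN eqP (@oner_neq0 K).
by case: (quad_char_cases y) => ->; case: He => ->; rewrite ?mulr0z ?mulrN1z ?mulr1z //;
  move=> E; by [case: N10|case: N11|case: o0].
Qed.

Lemma quad_charM (x y : K) : eta (x * y) = eta x * eta y.
Proof.
apply: quad_char_unique; last first.
  by rewrite rmorphM /= !quad_char_euler exprMn.
by case: (quad_char_cases x) => ->; case: (quad_char_cases y) => ->;
  first [by constructor 1 | by constructor 2 | by constructor 3].
Qed.

Lemma quad_char0 : eta 0 = 0. Proof. by rewrite /quad_char eqxx. Qed.

Lemma quad_char1 : eta 1 = 1.
Proof. by rewrite /quad_char oner_eq0 expr1n eqxx. Qed.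

Lemma quad_char_eq0 (y : K) : (eta y == 0) = (y == 0).
Proof. by rewrite /quad_char; case: (y == 0) => //; case: ifP. Qed.

Lemma quad_charX (y : K) n : eta (y ^+ n) = eta y ^+ n.
Proof. by elim: n => [|n IH]; rewrite ?quad_char1 // !exprS quad_charM IH. Qed.

Lemma quad_char_sqr (y : K) : y != 0 -> eta (y ^+ 2) = 1.
Proof.
move=> y0; apply: quad_char_unique; first by constructor 2.
by rewrite mulr1z -exprM mulnC exprM expf_half_sqr.
Qed.

(** Otherwise all [#|K| - 1] nonzero elements would be roots of [P], whose degree is only half of
    that. *)
Lemma exists_nonsquare : exists c : K, eta c = -1.
Proof.
case: (pickP (fun c : K => eta c == -1)) => [c /eqP|allsq]; first by exists c.
pose P : {poly K} := 'X^(#|K|./2) - 1.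
have szP : size P = #|K|./2.+1 by rewrite size_XnsubC ?half_gt0.
have P0 : P != 0 by rewrite -size_poly_eq0 szP.
have := max_poly_roots P0 (rs := enum (predC1 (0 : K))).
rewrite enum_uniq -cardE => /(_ _ isT) Hr.
have: (#|predC1 (0%R : K)| < size P)%N.
  apply: Hr; apply/allP => y; rewrite mem_enum inE => y0.
  rewrite rootE !hornerE -quad_char_euler; have := allsq y.
  move: y0; rewrite -quad_char_eq0.
  by case: (quad_char_cases y) => ->; rewrite ?subrr.
rewrite cardC1 szP card_half /= -addnn ltnS.
by have := half_gt0; lia.
Qed.

Lemma sum_quad_char : \sum_(y : K) eta y = 0.
Proof.
have [c etac] := exists_nonsquare.
have c0 : c != 0 by rewrite -quad_char_eq0 etac.
have: \sum_(y : K) eta y = - \sum_(y : K) eta y.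
  rewrite {1}(reindex_inj (mulfI c0)) /= -sumrN.
  by apply: eq_bigr => y _; rewrite quad_charM etac mulN1r.
lia.
Qed.

Lemma card_sqrt_le (z : K) : (#|[set y : K | y ^+ 2 == z]|%:Z <= 1 + eta z).
Proof.
have [->|z0] := eqVneq z 0.
  rewrite quad_char0 (_ : [set _ | _] = [set 0]) ?cards1 //.
  by apply/setP => y; rewrite !inE expf_eq0.
case: (pickP (fun y : K => y ^+ 2 == z)) => [y /eqP yz|none]; last first.
  rewrite (_ : [set _ | _] = set0) ?cards0; last by apply/setP => y; rewrite !inE none.
  by case: (quad_char_cases z) => ->.
have y0 : y != 0 by apply: contraNneq z0 => y0; rewrite -yz y0 expr0n.
rewrite -yz quad_char_sqr // (_ : [set _ | _] = [set y; -y]); last first.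
  by apply/setP => x; rewrite !inE eqf_sqr.
by rewrite cards2; case: (_ != _).
Qed.

Lemma sum_card_fibers (T : finType) (g : T -> K) :
  (\sum_(z : K) #|[set y | g y == z]|)%N = #|T|.
Proof.
rewrite -sum1_card (partition_big g predT) //=.
by apply: eq_bigr => z _; rewrite -sum1_card; apply: eq_bigl => y; rewrite inE.
Qed.

(** [card_sqrt_le] gives one inequality for each [z]; summed over [z] both sides equal [#|K|], so it
    is never strict. *)
Lemma card_sqrt (z : K) : #|[set y : K | y ^+ 2 == z]|%:Z = 1 + eta z.
Proof.
have [//|lt_z] : #|[set y : K | y ^+ 2 == z]|%:Z = 1 + eta z \/
  #|[set y : K | y ^+ 2 == z]|%:Z < 1 + eta z.
  by have := card_sqrt_le z; rewrite le_eqVlt => /orP[/eqP|]; [left|right].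
have: \sum_(z : K) #|[set y : K | y ^+ 2 == z]|%:Z < \sum_(z : K) (1 + eta z).
  rewrite (bigD1 z) //= [ltRHS](bigD1 z) //= ltr_leD //.
  by apply: ler_sum => y _; exact: card_sqrt_le.
rewrite big_split /= sum_quad_char addr0 sumr_const.
rewrite -[in ltRHS](sum_card_fibers (fun y : K => y ^+ 2)) natr_sum.
by rewrite [in ltRHS](eq_bigr _ (fun i _ => natz _)) ltxx.
Qed.

Lemma sum_comp_sqr (g : K -> int) :
  \sum_(y : K) g (y ^+ 2) = \sum_(z : K) (1 + eta z) * g z.
Proof.
rewrite (partition_big (fun y : K => y ^+ 2) predT) //=.
apply: eq_bigr => z _; rewrite (eq_bigr (fun=> g z)); last by move=> y /eqP->.
rewrite sumr_const -card_sqrt mulrC -mulr_natr natz; congr (_ * Posz _).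
by apply: eq_card => y; rewrite inE.
Qed.

Lemma sum_quad_char_shift (u : K) : \sum_(y : K) eta (y + u) = 0.
Proof. by rewrite -[RHS]sum_quad_char [RHS](reindex_inj (addIr u)). Qed.

Lemma sum_quad_char_sqr_sub (D : K) : D != 0 ->
  \sum_(y : K) eta (y ^+ 2 - D) = -1.
Proof.
move=> D0; rewrite (sum_comp_sqr (fun z => eta (z - D))).
under eq_bigr do rewrite mulrDl mul1r -quad_charM.
rewrite big_split /= sum_quad_char_shift add0r (bigD1 0) //= mul0r quad_char0 add0r.
(* Since the inverse of 0 is 0 here, the argument runs through all of [K]. The term at [w = 0] is 1,
   so the others, which are the terms [eta (z * (z - D))] divided by squares, add up to -1. *)
have: \sum_(w : K) eta (1 - D * w^-1) = 0.
  have inj : injective (fun w : K => 1 - D * w^-1).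
    by move=> x y /addrI/oppr_inj/(mulfI D0)/invr_inj.
  by rewrite -[RHS]sum_quad_char [RHS](reindex_inj inj).
rewrite (bigD1 0) //= invr0 mulr0 subr0 quad_char1 => /eqP.
rewrite addrC addr_eq0 => /eqP <-; apply: eq_bigr => z z0.
rewrite -[RHS]mul1r -(quad_char_sqr z0) -quad_charM; congr quad_char.
by field.
Qed.

Lemma sum_quad_char_quadratic (u v : K) : u ^+ 2 != 4%:R * v ->
  \sum_(y : K) eta (y ^+ 2 + u * y + v) = -1.
Proof.
move=> disc; have two := two_neq0.
have D0 : u ^+ 2 / 4%:R - v != 0.
  apply: contraNneq disc => E; apply/eqP; have : u ^+ 2 = 4%:R * (u ^+ 2 / 4%:R - v) + 4%:R * v.
    by field; rewrite (natrM _ 2 2) mulf_neq0.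
  by rewrite E mulr0 add0r.
rewrite -(sum_quad_char_sqr_sub D0) [RHS](reindex_inj (addIr (u / 2%:R))) /=.
apply: eq_bigr => y _; congr quad_char; field.
by rewrite (natrM _ 2 2) mulf_neq0.
Qed.

Lemma affine_count_quad_char (a b : nat) : (affine_count K a b)%:Z =
  #|K|%:Z + \sum_(x : K) eta (x ^+ 3 + a%:R * x + b%:R).
Proof.
rewrite /affine_count -sum1dep_card.
rewrite (eq_bigl (fun z : K * K => predT z.1 && (z.2 ^+ 2 == z.1 ^+ 3 + a%:R * z.1 + b%:R))) //.
rewrite -(pair_big_dep predT (fun x y => y ^+ 2 == x ^+ 3 + a%:R * x + b%:R) (fun _ _ => 1%N)) /=.
rewrite -natz natr_sum -sum1_card -natz natr_sum -big_split /=.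
by apply: eq_bigr => x _; rewrite natz -card_sqrt sum1dep_card.
Qed.

(** The square factor has character 1 except at [x = al], so the sum is a complete sum of a linear
    polynomial minus its term at [al]. *)
Lemma sum_quad_char_singular (al : K) :
  \sum_(x : K) eta ((x - al) ^+ 2 * (x + 2%:R * al)) = - eta (3%:R * al).
Proof.
have := sum_quad_char_shift (2%:R * al); rewrite (bigD1 al) //= => /eqP.
rewrite addrC addr_eq0 (_ : al + 2%:R * al = 3%:R * al); last by ring.
move/eqP <-; rewrite (bigD1 al) //= subrr expr0n mul0r quad_char0 add0r.
by apply: eq_bigr => x xal; rewrite quad_charM quad_char_sqr ?mul1r ?subr_eq0.
Qed.

End QuadraticCharacter.

(** Both halves round down, so this is [(q^i - 1)/2 = (q - 1)/2 * (1 + q + ... + q^(i-1))]: Euler's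
    exponent upstairs is the norm exponent times Euler's exponent downstairs. *)
Lemma half_expn_geom (q i : nat) : odd q ->
  ((q ^ i)./2 = q./2 * \sum_(t < i) q ^ t)%N.
Proof.
move=> oddq; have geom : (q ^ i = (q./2 * \sum_(t < i) q ^ t).*2.+1)%N.
  elim: i => [|i IH]; first by rewrite big_ord0 muln0.
  have qE : q = (q./2).*2.+1 by rewrite -[LHS]odd_double_half oddq.
  rewrite big_ord_recr /= mulnDr doubleD -addSn -IH expnS {1}qE mulSn.
  by rewrite doubleMl.
by rewrite {1}geom /= uphalf_double.
Qed.

(* The product is the norm of [y] from [K] to [F]. *)
Lemma quad_char_norm (F K : finFieldType) (iota : {rmorphism F -> K}) i (y : K) (z : F) :
  odd #|F| -> #|K| = (#|F| ^ i)%N ->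
  iota z = \prod_(t < i) y ^+ (#|F| ^ t) -> quad_char y = quad_char z.
Proof.
move=> oddF cardK zE; have oddK : odd #|K| by rewrite cardK oddX oddF orbT.
apply: (quad_char_unique oddK); first exact: quad_char_cases.
rewrite -(rmorph_int iota) (quad_char_euler oddF) rmorphXn /= zE cardK half_expn_geom //.
by rewrite prodrXr -exprM mulnC.
Qed.

(** The norm of an element of the base field is its [i]-th power. *)
Lemma quad_char_rmorph (F K : finFieldType) (iota : {rmorphism F -> K}) i (y : F) :
  odd #|F| -> #|K| = (#|F| ^ i)%N -> quad_char (iota y) = quad_char y ^+ i.
Proof.
move=> oddF cardK; rewrite -(quad_charX oddF).
apply: (quad_char_norm (iota := iota) oddF cardK).
rewrite rmorphXn /= (eq_bigr (fun=> iota y)) ?prodr_const ?card_ord //.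
move=> t _; elim: (t : nat) => [|n IH]; first by rewrite expr1.
by rewrite expnSr exprM IH -rmorphXn /= expf_card.
Qed.

(** * Monic polynomials over a finite field *)

Section MonicPolynomials.
Variable F : finFieldType.
Implicit Types (g h P : {poly F}) (chi : {poly F} -> int).

Definition monics (n : nat) : seq {poly F} :=
  [seq 'X^n + rVpoly v | v <- enum {: 'rV[F]_n}].

Definition monic_irreds (n : nat) : seq {poly F} :=
  [seq P <- monics n | irreducibleb P].

Lemma size_monic_of_row n (v : 'rV[F]_n) : size ('X^n + rVpoly v) = n.+1.
Proof. by rewrite size_polyDl size_polyXn // ltnS size_poly. Qed.

Lemma mem_monics n h : (h \in monics n) = (h \is monic) && (size h == n.+1).
Proof.
apply/mapP/andP => [[v _ ->]|[mon_h /eqP sz_h]].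
  rewrite size_monic_of_row eqxx monicE lead_coefDl ?lead_coefXn //.
  by rewrite size_polyXn ltnS size_poly.
exists (poly_rV (h - 'X^n)); rewrite ?mem_enum //.
rewrite poly_rV_K ?subrKC //; apply/leq_sizeP => j; rewrite coefB coefXn.
rewrite leq_eqVlt => /orP[/eqP<-|nj]; last first.
  by rewrite gtn_eqF // subr0 nth_default // sz_h.
by rewrite eqxx; move/monicP: mon_h; rewrite lead_coefE sz_h /= => ->; rewrite subrr.
Qed.

Lemma monics_uniq n : uniq (monics n).
Proof.
by rewrite map_inj_uniq ?enum_uniq // => u v /addrI/(can_inj rVpolyK).
Qed.

Lemma size_monics n : size (monics n) = (#|F| ^ n)%N.
Proof. by rewrite size_map -cardE card_mx mul1n. Qed.

Lemma monic_size1 h : h \is monic -> size h = 1%N -> h = 1.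
Proof.
move=> mh sz; have hE := size1_polyC (eq_leq sz).
by move: mh; rewrite hE => /monicP; rewrite lead_coefC => ->.
Qed.

Lemma monics0 : monics 0 = [:: 1].
Proof.
apply: (perm_small_eq _ (uniq_perm (monics_uniq 0) _ _)) => //.
move=> h; rewrite mem_monics inE; apply/andP/eqP => [[mh /eqP sz]|->]; last first.
  by rewrite monic1 size_poly1.
exact: monic_size1.
Qed.

Lemma mem_monic_irreds n P : P \in monic_irreds n ->
  [/\ P \is monic, irreducible_poly P & size P = n.+1].
Proof.
by rewrite mem_filter mem_monics => /and3P[/irreducibleP irrP mP /eqP].
Qed.

Lemma monic_irreds_mem P : P \is monic -> irreducible_poly P ->
  P \in monic_irreds (size P).-1.
Proof.
move=> mP irrP; rewrite mem_filter mem_monics mP.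
rewrite prednK ?eqxx ?andbT; first exact/irreducibleP.
by case: irrP => /ltnW.
Qed.

Lemma monic_eqp_eq g h : g \is monic -> h \is monic -> g %= h -> g = h.
Proof. by move=> mg mh; rewrite eqp_monic // => /eqP. Qed.

Lemma perm_monics_dvdp n d Q : Q \is monic -> size Q = d.+1 -> (d <= n)%N ->
  perm_eq [seq h <- monics n | Q %| h] [seq Q * g | g <- monics (n - d)].
Proof.
move=> mQ szQ dn; apply: uniq_perm; first exact/filter_uniq/monics_uniq.
  rewrite map_inj_uniq ?monics_uniq //; apply: mulfI; exact: monic_neq0.
move=> h; rewrite mem_filter mem_monics; apply/and3P/mapP.
  move=> [/dvdpP[g ->] mgQ /eqP szgQ]; exists g; last by rewrite mulrC.
  have mg : g \is monic by rewrite -(monicMr _ mQ).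
  rewrite mem_monics mg; move: szgQ; rewrite size_Mmonic ?monic_neq0 //.
  by rewrite szQ addnS /=; lia.
move=> [g]; rewrite mem_monics => /andP[mg /eqP szg] ->.
rewrite dvdp_mulr ?dvdpp // rpredM // size_Mmonic ?monic_neq0 // szQ szg.
by split=> //; apply/eqP; lia.
Qed.

Lemma monics_dvdp0 n d Q : Q \is monic -> size Q = d.+1 -> (n < d)%N ->
  [seq h <- monics n | Q %| h] = [::].
Proof.
move=> mQ szQ nd; apply/eqP; rewrite -[_ == _]negbK -has_filter; apply/hasPn => h.
rewrite mem_monics => /andP[mh /eqP szh]; apply/negP => /dvdp_leq.
by rewrite szQ szh monic_neq0 // => /(_ isT); rewrite ltnS leqNgt nd.
Qed.

Lemma monic_factorization h : h \is monic ->
  exists2 s : seq {poly F}, {in s, forall P, P \is monic /\ irreducible_poly P}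
    & h = \prod_(P <- s) P.
Proof.
have [n] := ubnP (size h); elim: n h => // n IH h szh mh.
have [sz1|szN1] := eqVneq (size h) 1%N.
  by exists [::] => //; rewrite big_nil; exact: monic_size1.
have [irr|/irreducibleP] := irreducibleP h.
  by exists [:: h]; rewrite ?big_seq1 // => P; rewrite inE => /eqP->.
have sz_gt1 : (1 < size h)%N.
  by case: (size h) (monic_neq0 mh) szN1 (size_poly_eq0 h) => [|[|k]] // /negPf->.
rewrite /irreducibleb sz_gt1 /= => /forallPn[[q szq] /=].
rewrite negb_imply -ltnNge => /andP[+ q_gt1]; rewrite -Pdiv.Idomain.dvdpE => qh.
have lq0 : (lead_coef q)^-1 != 0.
  by rewrite invr_eq0 lead_coef_eq0 -size_poly_eq0; case: (size q) q_gt1.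
pose g := (lead_coef q)^-1 *: q.
have mg : g \is monic by rewrite monicE lead_coefZ mulVf // -invr_eq0.
have szg : size g = size q by rewrite size_scale.
have /dvdpP[k hE] : g %| h by rewrite dvdpZl.
have mk : k \is monic by rewrite -(monicMr _ mg) -hE.
have szkg : size h = (size k + size g).-1 by rewrite hE size_Mmonic ?monic_neq0.
have szk : (0 < size k)%N by rewrite size_poly_gt0 monic_neq0.
have ltg : (size g < n)%N.
  rewrite szg -ltnS; apply: leq_trans szh; rewrite ltnS.
  have szq_le : (size q <= (size h).-1)%N := szq.
  by apply: leq_ltn_trans szq_le _; rewrite prednK // ltnW.
have ltk : (size k < n)%N.
  move: szh; rewrite szkg szg; move: q_gt1 szk.
  by move: (size q) (size k) => a b; lia.
have [s1 s1irr gE] := IH g ltg mg.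
have [s2 s2irr kE] := IH k ltk mk.
exists (s2 ++ s1); last by rewrite big_cat /= -gE -kE.
by move=> P; rewrite mem_cat => /orP[/s2irr|/s1irr].
Qed.

(** Factors are peeled off one by one: a factor equal to [P] cancels one power, and any other monic
    irreducible factor is coprime to [P]. *)
Lemma dvdp_exp_prod_irred P (s : seq {poly F}) m :
  P \is monic -> irreducible_poly P ->
  {in s, forall Q, Q \is monic /\ irreducible_poly Q} ->
  (P ^+ m %| \prod_(Q <- s) Q) = (m <= count_mem P s)%N.
Proof.
move=> mP irrP; elim: s m => [|Q s IH] m sirr.
  rewrite big_nil dvdp1 leqn0; case: m => [|m]; first by rewrite expr0 size_poly1.
  apply/negbTE; have sP : (1 < size P)%N by case: irrP.
  by rewrite -dvdp1 exprS; apply/negP => /(dvdp_trans (dvdp_mulr _ (dvdpp P)));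
    rewrite dvdp1; case: size sP => [|[]].
have sirr' : {in s, forall Q, Q \is monic /\ irreducible_poly Q}.
  by move=> R Rs; apply: sirr; rewrite inE Rs orbT.
have [mQ irrQ] := sirr Q (mem_head _ _).
rewrite big_cons /=; have [->|neqQP] := eqVneq Q P.
  case: m => [|m]; first by rewrite expr0 dvd1p.
  by rewrite exprS dvdp_mul2l ?monic_neq0 // IH.
rewrite add0n Gauss_dvdpr ?IH // coprimep_expl //.
rewrite irreducible_poly_coprime //; apply/negP => PQ.
have sP : (size P != 1)%N by case: irrP; case: size => [|[]].
move/eqP: neqQP; apply; apply/esym/monic_eqp_eq => //.
exact: apply_irredp irrQ _ sP PQ.
Qed.

Lemma count_prefix c n : (c <= n)%N -> (\sum_(1 <= m < n.+1) (m <= c) = c)%N.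
Proof.
move=> cn; rewrite (@big_cat_nat _ _ _ c.+1) //= ?ltnS //.
rewrite (eq_big_nat _ _ (F2 := fun=> 1%N)); last by move=> m /andP[_]; rewrite ltnS => ->.
rewrite sum_nat_const_nat subn1 muln1 [X in (_ + X)%N]big_nat_cond big1 ?addn0 //.
by move=> m /andP[/andP[cm _] _]; rewrite leqNgt cm.
Qed.

Lemma size_prod_monic (s : seq {poly F}) :
  {in s, forall P, P \is monic} ->
  size (\prod_(P <- s) P) = (\sum_(P <- s) (size P).-1).+1.
Proof.
elim: s => [|P s IH] ms; first by rewrite !big_nil size_poly1.
have ms' : {in s, forall P, P \is monic}.
  by move=> Q Qs; apply: ms; rewrite inE Qs orbT.
have mP := ms P (mem_head _ _).
have mprod : \prod_(Q <- s) Q \is monic.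
  by rewrite big_seq; apply: monic_prod => Q /ms'.
rewrite !big_cons size_Mmonic ?monic_neq0 //.
rewrite IH // addnS /= -[in LHS](prednK (_ : 0 < size P)%N) ?addSn //.
by rewrite size_poly_gt0 monic_neq0.
Qed.

Lemma sum_count_irreds (s : seq {poly F}) n :
  {in s, forall P, P \is monic /\ irreducible_poly P} ->
  (\sum_(P <- s) (size P).-1 = n)%N ->
  (\sum_(1 <= d < n.+1) \sum_(P <- monic_irreds d) d * count_mem P s = n)%N.
Proof.
move=> sirr sn.
have sz_le P : P \in s -> ((size P).-1 <= n)%N.
  by move=> Ps; rewrite -sn (big_rem P) //= leq_addr.
rewrite -[RHS]sn.
under eq_bigr do under eq_bigr do rewrite -sum1_count big_distrr big_mkcond /=.
under eq_bigr do rewrite exchange_big /=.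
rewrite exchange_big /= [LHS]big_seq [RHS]big_seq; apply: eq_bigr => R Rs.
have [mR irrR] := sirr R Rs.
have szR : (1 < size R)%N by case: irrR.
rewrite (bigD1_seq (size R).-1) /= ?iota_uniq //; last first.
  by rewrite mem_index_iota ltnS sz_le // andbT; case: (size R) szR => [|[|k]].
rewrite (bigD1_seq R) /= ?filter_uniq ?monics_uniq ?monic_irreds_mem //.
rewrite eqxx muln1 big1 ?addn0 => [|P /negPf]; last by rewrite eq_sym => ->.
rewrite big1 ?addn0 // => d dR; rewrite big_seq big1 // => P /mem_monic_irreds[_ _ szP].
by case: eqP => // RP; move: dR; rewrite RP szP eqxx.
Qed.

(** The polynomial analogue of the identity that the von Mangoldt function, summed over the divisors
    of a number, gives its logarithm: each prime power dividing [h] contributes the degree of its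
    prime. *)
Lemma degree_irreds n h : h \in monics n ->
  (\sum_(1 <= d < n.+1) \sum_(P <- monic_irreds d) \sum_(1 <= m < n.+1)
     d * (P ^+ m %| h)%R = n)%N.
Proof.
rewrite mem_monics => /andP[mh /eqP szh].
have [s sirr hE] := monic_factorization mh.
have sn : (\sum_(P <- s) (size P).-1 = n)%N.
  by apply: succn_inj; rewrite -szh hE size_prod_monic // => P /sirr[].
rewrite -[RHS](sum_count_irreds sirr sn); apply: eq_bigr => d _.
rewrite big_seq [RHS]big_seq; apply: eq_bigr => P Pd.
have [mP irrP szP] := mem_monic_irreds Pd.
rewrite -big_distrr /=; congr (_ * _)%N; rewrite -[RHS](@count_prefix _ n); last first.
  rewrite -sn -sum1_count big_mkcond big_seq [X in (_ <= X)%N]big_seq /=.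
  by apply: leq_sum => Q /sirr[_ [szQ _]]; case: ifP => // _; case: (size Q) szQ => [|[]].
by apply: eq_bigr => m _; rewrite hE dvdp_exp_prod_irred.
Qed.

Lemma sum_multiples (H : nat -> int) d n : (0 < d)%N ->
  \sum_(1 <= i < n.+1 | (d %| i)%N) H i = \sum_(1 <= m < n.+1 | (d * m <= n)%N) H (d * m)%N.
Proof.
move=> d0; rewrite -big_filter -[RHS]big_filter -(big_map (muln d) predT H).
apply: perm_big; apply: uniq_perm; rewrite ?filter_uniq ?iota_uniq //.
  by rewrite map_inj_uniq ?filter_uniq ?iota_uniq // => x y /eqP; rewrite eqn_pmul2l // => /eqP.
move=> i; rewrite mem_filter mem_index_iota; apply/idP/mapP.
  move=> /and3P[/dvdnP[m ->] i0 ilt]; exists m; rewrite 1?mulnC //.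
  by rewrite mem_filter mem_index_iota; nia.
move=> [m]; rewrite mem_filter mem_index_iota => /andP[le /andP[m0 _]] ->.
by rewrite dvdn_mulr //=; nia.
Qed.

Definition monic_sum chi n : int := \sum_(h <- monics n) chi h.

(** The coefficient of [T^i] in [T L' / L]: a sum over prime powers [P^m] of degree [i], each
    weighted by the degree of [P]. *)
Definition prime_power_sum chi i : int :=
  \sum_(1 <= d < i.+1 | (d %| i)%N) \sum_(P <- monic_irreds d) d%:Z * chi P ^+ (i %/ d).

(* The coefficient form of [T L' = L * (T L' / L)] for [L = sum_h chi h T^(deg h)], whose
   logarithmic derivative is read off the Euler product. *)
Lemma monic_sum_newton chi n : chi 1 = 1 ->
  (forall g h, g \is monic -> h \is monic -> chi (g * h) = chi g * chi h) ->
  n%:Z * monic_sum chi n =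
  \sum_(1 <= i < n.+1) prime_power_sum chi i * monic_sum chi (n - i).
Proof.
move=> chi1 chiM.
have chiX P m : P \is monic -> chi (P ^+ m) = chi P ^+ m.
  move=> mP; elim: m => [|m IH]; rewrite ?chi1 // !exprS chiM ?IH //; exact: rpredX.
(* The factor [n] is expanded for each [h] by [degree_irreds], and the sums are exchanged. *)
have -> : n%:Z * monic_sum chi n = \sum_(1 <= d < n.+1) \sum_(P <- monic_irreds d)
    \sum_(1 <= m < n.+1) d%:Z * \sum_(h <- monics n | P ^+ m %| h) chi h.
  transitivity (\sum_(h <- monics n) \sum_(1 <= d < n.+1) \sum_(P <- monic_irreds d)
    \sum_(1 <= m < n.+1) (d * (P ^+ m %| h)%R)%N%:Z * chi h).
    rewrite big_distrr /= big_seq [RHS]big_seq; apply: eq_bigr => h hn.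
    rewrite -{1}(degree_irreds hn) -natz natr_sum big_distrl /=.
    apply: eq_bigr => d _; rewrite natr_sum big_distrl /=.
    apply: eq_bigr => P _; rewrite natr_sum big_distrl /=.
    by apply: eq_bigr => m _; rewrite natz.
  rewrite exchange_big; apply: eq_bigr => d _.
  rewrite exchange_big; apply: eq_bigr => P _.
  rewrite exchange_big; apply: eq_bigr => m _.
  rewrite big_distrr [RHS]big_mkcond /=; apply: eq_bigr => h _.
  by case: ifP => _; rewrite ?muln1 // muln0 mul0r.
have -> : \sum_(1 <= i < n.+1) prime_power_sum chi i * monic_sum chi (n - i) =
  \sum_(1 <= d < n.+1) \sum_(P <- monic_irreds d) \sum_(1 <= i < n.+1 | (d %| i)%N)
    (d%:Z * chi P ^+ (i %/ d) * monic_sum chi (n - i)).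
  under [RHS]eq_bigr do rewrite exchange_big /=.
  under [RHS]eq_bigr do rewrite big_mkcond /=.
  rewrite [RHS]exchange_big /=; apply: eq_big_nat => i /andP[i0 ilt].
  rewrite /prime_power_sum big_distrl /= -big_mkcond /=.
  rewrite [RHS](@big_cat_nat _ _ _ i.+1) //= [X in _ + X]big_nat_cond [X in _ + X]big1 ?addr0.
    by apply: eq_bigr => d _; rewrite big_distrl.
  move=> d /andP[/andP[id _] /dvdn_leq]; lia.
apply: eq_big_nat => d /andP[d0 _]; rewrite big_seq [RHS]big_seq.
apply: eq_bigr => P /mem_monic_irreds[mP _ szP].
rewrite sum_multiples // [RHS]big_mkcond /=; apply: eq_bigr => m _.
have szPm : size (P ^+ m) = (d * m).+1.
  have := size_exp P m; rewrite szP /= => <-; rewrite prednK // size_poly_gt0.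
  by rewrite monic_neq0 ?rpredX.
have mPm : P ^+ m \is monic by rewrite rpredX.
case: leqP => dmn; last by rewrite -big_filter (monics_dvdp0 mPm szPm dmn) big_nil mulr0.
rewrite -big_filter (perm_big _ (perm_monics_dvdp mPm szPm dmn)) big_map.
rewrite mulKn // -mulrA; congr (_ * _); rewrite big_distrr /= big_seq [RHS]big_seq.
by apply: eq_bigr => g; rewrite mem_monics => /andP[mg _]; rewrite chiM // chiX.
Qed.

End MonicPolynomials.

(** * Sums over extension fields *)

Section FrobeniusConjugates.
Variables (F K : finFieldType) (iota : {rmorphism F -> K}) (i : nat).
Hypothesis cardK : #|K| = (#|F| ^ i)%N.
Local Notation q := #|F|.
Local Notation "P ^iota" := (map_poly iota P) (at level 2, format "P ^iota").

Lemma frobenius_rmorphism : {phi : {rmorphism K -> K} | forall x, phi x = x ^+ q}.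
Proof.
have fA : zmod_morphism (fun x : K => x ^+ q).
  move=> x y /=; have [p _ charF] := finPcharP F; rewrite (card_pprimeChar charF).
  have charK : p \in [pchar K] by rewrite (fmorph_pchar iota).
  elim: (logn _ _) => // n IHn; rewrite expnSr !exprM {}IHn.
  by rewrite -(pFrobenius_autE charK) rmorphB.
have fM : monoid_morphism (fun x : K => x ^+ q).
  by split=> [|x y]; rewrite ?exprMn ?expr1n.
pose faM := GRing.isZmodMorphism.Build _ _ (fun x : K => x ^+ q) fA.
pose fmM := GRing.isMonoidMorphism.Build _ _ (fun x : K => x ^+ q) fM.
by exists (HB.pack (fun x : K => x ^+ q) faM fmM : {rmorphism K -> K}).
Qed.

(** [X^q - X] is the product of all [X - z] with [z] in [F], so its roots in [K] already come from
    [F]. *)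
Lemma frobenius_fixed (y : K) : y ^+ q = y -> exists z, iota z = y.
Proof.
move=> yq; have: root ('X^q - 'X : {poly F})^iota y.
  by rewrite rmorphB /= map_polyXn map_polyX rootE !hornerE yq subrr.
rewrite finField_genPoly map_prod_XsubC.
rewrite -(big_map iota predT (fun a => 'X - a%:P)) root_prod_XsubC.
by case/mapP => z _ ->; exists z.
Qed.

(** The characteristic polynomial of multiplication by [x] over [F]; conjugates repeat when [x] lies
    in a proper subfield. *)
Definition conj_poly (x : K) : {poly K} := \prod_(t < i) ('X - (x ^+ (q ^ t))%:P).

Lemma conj_poly_monic x : conj_poly x \is monic.
Proof. exact: monic_prod_XsubC. Qed.

Lemma size_conj_poly x : size (conj_poly x) = i.+1.
Proof.
rewrite /conj_poly size_prod_XsubC /index_enum -enumT size_enum_ord //.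
Qed.

Lemma ext_degree_gt0 : (0 < i)%N.
Proof. by have := finNzRing_gt1 K; rewrite cardK; case: i. Qed.

Lemma conj_poly_fixed x (phi : {rmorphism K -> K}) :
  (forall x, phi x = x ^+ q) -> map_poly phi (conj_poly x) = conj_poly x.
Proof.
move=> phiE; rewrite /conj_poly map_prod_XsubC.
under eq_bigr do rewrite phiE -exprM -expnSr.
have := ext_degree_gt0; move: (expf_card x); rewrite cardK.
case: i => // k xK _; rewrite big_ord_recr [RHS]big_ord_recl /= xK mulrC.
by rewrite expn0 expr1; congr (_ * _); apply: eq_bigr.
Qed.

(** Frobenius permutes the linear factors cyclically, so every coefficient is fixed and lies in the
    image of [F]. *)
Lemma conj_poly_descends x : exists2 Q : {poly F}, Q \is monic & Q^iota = conj_poly x.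
Proof.
have [phi phiE] := frobenius_rmorphism.
have fixc j : exists z, iota z == (conj_poly x)`_j.
  have [|z <-] := @frobenius_fixed (conj_poly x)`_j; last by exists z.
  by rewrite -phiE -coef_map conj_poly_fixed.
pose Q := \poly_(j < i.+1) xchoose (fixc j).
have QE : Q^iota = conj_poly x.
  apply/polyP => j; rewrite coef_map coef_poly; case: ltnP => [_|ij].
    exact/eqP/(xchooseP (fixc j)).
  by rewrite nth_default ?size_conj_poly //; exact: rmorph0.
exists Q => //; rewrite -(map_monic iota) QE; exact: conj_poly_monic.
Qed.

Lemma root_map_conj (P : {poly F}) x t : root P^iota (x ^+ (q ^ t)) -> root P^iota x.
Proof.
have [phi phiE] := frobenius_rmorphism.
elim: t => [|t IH]; first by rewrite expn0 expr1.
rewrite expnSr exprM -phiE => rt; apply: IH; move: rt.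
have phiP : map_poly phi P^iota = P^iota.
  by apply/polyP => j; rewrite !coef_map /= phiE -rmorphXn /= expf_card.
by rewrite !rootE -{1}phiP horner_map fmorph_eq0.
Qed.

Lemma irreducible_root_unique (P R : {poly F}) x :
  P \is monic -> irreducible_poly P -> R \is monic -> irreducible_poly R ->
  root P^iota x -> root R^iota x -> P = R.
Proof.
move=> mP irrP mR irrR rP rR; apply: monic_eqp_eq => //.
have [PR|] := boolP (P %| R).
  by apply: apply_irredp irrR _ _ PR; case: irrP; case: size => [|[]].
rewrite -irreducible_poly_coprime // -(coprimep_map iota) => /coprimep_root/(_ rP).
by rewrite -rootE rR.
Qed.

(** Every irreducible factor of [Q] vanishes at a conjugate of [x], hence at [x] itself, and only
    one monic irreducible polynomial over [F] does so. *)
Lemma conj_poly_power x (Q : {poly F}) : Q \is monic -> Q^iota = conj_poly x ->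
  exists P m, [/\ P \is monic, irreducible_poly P, root P^iota x, Q = P ^+ m
    & ((size P).-1 * m = i)%N].
Proof.
move=> mQ QE; have [s sirr sE] := monic_factorization mQ.
have rootQ : root Q^iota x.
  rewrite QE rootE; have := ext_degree_gt0; rewrite /conj_poly.
  by case: i => // k _; rewrite big_ord_recl hornerM expn0 expr1 !hornerE subrr mul0r.
have rs R : R \in s -> root R^iota x.
  move=> Rs; have [mR irrR] := sirr R Rs.
  have: R^iota %| conj_poly x.
    by rewrite -QE sE (big_rem R) //= rmorphM /= dvdp_mulr.
  case/dvdp_prod_XsubC => m Rm.
  have: (1 < size R^iota)%N by rewrite size_map_poly; case: irrR.
  rewrite (eqp_size Rm); case E : (mask _ _) => [|t r]; first by rewrite big_nil size_poly1.
  move=> _; apply: (@root_map_conj _ _ t); rewrite (eqp_root Rm) E big_cons.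
  by rewrite rootM root_XsubC eqxx.
have: (0 < size s)%N.
  rewrite lt0n; apply: contraTneq rootQ => /size0nil s0.
  by rewrite sE s0 big_nil rmorph1 root1.
case: s => // P s in sirr sE rs * => _; exists P, (size s).+1.
have [mP irrP] := sirr P (mem_head _ _); have rP := rs P (mem_head _ _).
have QP : Q = P ^+ (size s).+1.
  rewrite sE big_cons exprS; congr (_ * _); rewrite big_seq (eq_bigr (fun=> P)) => [|R Rs].
    by rewrite -big_seq big_const_seq count_predT iter_mulr_1.
  have Rs' : R \in P :: s by rewrite inE Rs orbT.
  have [mR irrR] := sirr R Rs'; exact: irreducible_root_unique (rs R Rs') rP.
split=> //; have := size_exp P (size s).+1.
by rewrite -QP -(size_map_poly iota) QE size_conj_poly.
Qed.

End FrobeniusConjugates.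

(** * Sums over the extension field as sums over prime powers in [F[X]] *)

Section SumOverExtension.
Variables (F K : finFieldType) (iota : {rmorphism F -> K}) (i : nat).
Hypothesis cardK : #|K| = (#|F| ^ i)%N.
Local Notation q := #|F|.
Local Notation "P ^iota" := (map_poly iota P) (at level 2, format "P ^iota").

Lemma prime_power_sum1 n : (0 < n)%N ->
  prime_power_sum (fun _ : {poly F} => 1) n = (q ^ n)%N%:Z.
Proof.
have msum k : monic_sum (fun _ : {poly F} => 1) k = (#|F| ^ k)%N%:Z.
  by rewrite /monic_sum big_const_seq count_predT iter_addr_0 size_monics natz.
elim/ltn_ind: n => n IH n0.
have := @monic_sum_newton F (fun=> 1) n erefl (fun _ _ _ _ => esym (mulr1 _)).
rewrite big_nat_recr //= subnn !msum expn0 mulr1.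
rewrite (eq_big_nat _ _ (F2 := fun=> (q ^ n)%N%:Z)) => [|k /andP[k0 kn]]; last first.
  by rewrite IH // msum -PoszM -expnD subnKC // ltnW.
rewrite sumr_const_nat -mulr_natl natz.
(* With all earlier terms equal to [q^n], Newton's identity reads [n q^n = (n - 1) q^n +] the wanted
   term. *)
case: n n0 IH => // n _ _; rewrite subn1 /= => E.
by apply: (addrI (n%:Z * (q ^ n.+1)%N%:Z)); rewrite -[LHS]E intS mulrDl mul1r addrC.
Qed.

(** The elements [x] are grouped by the irreducible [P] that vanishes at [x]; then [Q = P^(i/d)],
    with [d] the degree of [P]. *)
Lemma sum_conj_poly (chi : {poly F} -> int) (G : K -> int) :
  (forall P m, P \is monic -> chi (P ^+ m) = chi P ^+ m) ->
  (forall x Q, Q \is monic -> Q^iota = conj_poly F i x -> G x = chi Q) ->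
  \sum_(x : K) G x = \sum_(1 <= d < i.+1 | (d %| i)%N) \sum_(P <- monic_irreds F d)
     #|[set x | root P^iota x]|%:Z * chi P ^+ (i %/ d).
Proof.
move=> chiX GE; have i0 := ext_degree_gt0 cardK.
under [RHS]eq_bigr do under eq_bigr do rewrite -natz mulr_natl -sumr_const.
under [RHS]eq_bigr do under eq_bigr do rewrite big_mkcond /=.
under [RHS]eq_bigr do rewrite exchange_big /=.
rewrite [RHS]exchange_big /=; apply: eq_bigr => x _.
have [Q mQ QE] := conj_poly_descends iota cardK x.
have [P [m [mP irrP rP QP szP]]] := conj_poly_power cardK mQ QE.
set d := (size P).-1 in szP.
have szP1 : (1 < size P)%N by case: irrP.
have d0 : (0 < d)%N by rewrite /d -ltnS prednK // ltnW.
have di : (d %| i)%N by rewrite -szP dvdn_mulr.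
rewrite big_mkcond (bigD1_seq d) /= ?iota_uniq //; last first.
  by rewrite mem_index_iota ltnS d0 dvdn_leq.
rewrite di.
rewrite (bigD1_seq P) /= ?filter_uniq ?monics_uniq ?monic_irreds_mem //.
rewrite inE rP -szP mulKn // -chiX // -QP -(GE x) //.
rewrite big_seq_cond big1 ?addr0 => [|R /andP[Rd RP]]; last first.
  rewrite inE; case: ifP => // rR; have [mR irrR _] := mem_monic_irreds Rd.
  by rewrite (irreducible_root_unique mR irrR mP irrP rR rP) eqxx in RP.
rewrite big1 ?addr0 // => e ed; case: ifP => // _; rewrite big_seq big1 // => R Re.
rewrite inE; case: ifP => // rR; have [mR irrR szR] := mem_monic_irreds Re.
by move: ed; rewrite /d -(irreducible_root_unique mR irrR mP irrP rR rP) szR eqxx.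
Qed.

(* An irreducible polynomial of degree [d] has at most [d] roots. For the trivial character the
   two sides of [sum_conj_poly] with all root counts replaced by [d] agree, so none is smaller. *)
Lemma card_roots_irred d P : (0 < d)%N -> (d %| i)%N -> P \in monic_irreds F d ->
  #|[set x | root P^iota x]| = d.
Proof.
move=> d0 di Pd; have i0 := ext_degree_gt0 cardK.
have le e R : R \in monic_irreds F e -> (#|[set x | root R^iota x]| <= e)%N.
  move=> /mem_monic_irreds[mR _ szR]; rewrite -ltnS -szR -(size_map_poly iota).
  rewrite cardE; apply: max_poly_roots; rewrite ?enum_uniq ?map_poly_eq0 ?monic_neq0 //.
  by apply/allP => x; rewrite mem_enum inE.
apply/eqP; rewrite eqn_leq le //= leqNgt; apply/negP => lt.
have: \sum_(x : K) (1 : int) < prime_power_sum (fun _ : {poly F} => 1) i.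
  rewrite (@sum_conj_poly (fun=> 1)) // => [|R m _]; last by rewrite expr1n.
  rewrite /prime_power_sum big_mkcond [ltRHS]big_mkcond (bigD1_seq d) /= ?iota_uniq //; last first.
    by rewrite mem_index_iota ltnS d0 dvdn_leq.
  rewrite [ltRHS](bigD1_seq d) /= ?iota_uniq //; last first.
    by rewrite mem_index_iota ltnS d0 dvdn_leq.
  rewrite di; apply: ltr_leD.
    rewrite (bigD1_seq P) ?filter_uniq ?monics_uniq //=.
    rewrite [ltRHS](bigD1_seq P) ?filter_uniq ?monics_uniq //=.
    apply: ltr_leD; first by rewrite expr1n !mulr1 ltz_nat.
    by rewrite big_seq_cond [leRHS]big_seq_cond; apply: ler_sum => R /andP[Rd _];
      rewrite expr1n !mulr1 lez_nat le.
  apply: ler_sum => e _; case: ifP => // _; rewrite big_seq [leRHS]big_seq; apply: ler_sum => R Re.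
  by rewrite expr1n !mulr1 lez_nat le.
by rewrite sumr_const cardK prime_power_sum1 // natz ltxx.
Qed.

Lemma sum_extension (chi : {poly F} -> int) (G : K -> int) :
  (forall P m, P \is monic -> chi (P ^+ m) = chi P ^+ m) ->
  (forall x Q, Q \is monic -> Q^iota = conj_poly F i x -> G x = chi Q) ->
  \sum_(x : K) G x = prime_power_sum chi i.
Proof.
move=> chiX GE; rewrite (sum_conj_poly chiX GE).
rewrite big_nat_cond [RHS]big_nat_cond; apply: eq_bigr => d /andP[/andP[d0 _] di].
by rewrite big_seq [RHS]big_seq; apply: eq_bigr => P Pd; rewrite (card_roots_irred d0 di Pd).
Qed.

End SumOverExtension.

(** * The L-function of a cubic *)

Lemma det_sub_scalar (R : comNzRingType) n (C : 'M[R]_n) (y : R) :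
  \det (C - y%:M) = (-1) ^+ n * (char_poly C).[y].
Proof.
rewrite -[in RHS]/(horner_eval y (char_poly C)) /char_poly -det_map_mx.
rewrite -[C - _]opprK -scaleN1r detZ; congr (_ * \det _).
apply/matrixP => i j; rewrite !mxE opprB /= /horner_eval.
by rewrite !(hornerE, hornerMn).
Qed.

(** * The character of monic polynomials as a resultant symbol *)

Section ResidueCharacter.
Variables (F : finFieldType) (n' : nat) (C : 'M[F]_n'.+1).
Hypothesis oddF : odd #|F|.
Local Notation N := n'.+1.
Local Notation f := (char_poly C).

(* Up to sign the determinant is the resultant of [h] and [f]; the sign makes it the product
   of the values of [f] at the roots of [h]. *)
Definition residue_char (h : {poly F}) : int :=
  quad_char (((-1) ^+ N) ^+ (size h).-1 * \det (horner_mx C h)).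

Lemma residue_char1 : residue_char 1 = 1.
Proof. by rewrite /residue_char size_poly1 rmorph1 det1 expr0 mul1r quad_char1. Qed.

Lemma residue_charM g h : g \is monic -> h \is monic ->
  residue_char (g * h) = residue_char g * residue_char h.
Proof.
move=> mg mh; rewrite /residue_char -quad_charM //; congr quad_char.
rewrite rmorphM /= -mulmxE det_mulmx size_Mmonic ?monic_neq0 //.
have g0 : (0 < size g)%N by rewrite size_poly_gt0 monic_neq0.
have h0 : (0 < size h)%N by rewrite size_poly_gt0 monic_neq0.
have -> : (size g + size h).-1.-1 = ((size g).-1 + (size h).-1)%N.
  by move: g0 h0; case: (size g) => // a; case: (size h) => // b _ _; rewrite addnS.
by rewrite exprD mulrACA.
Qed.

Lemma residue_charX g m : g \is monic -> residue_char (g ^+ m) = residue_char g ^+ m.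
Proof.
move=> mg; elim: m => [|m IH]; first by rewrite residue_char1.
by rewrite !exprS residue_charM ?IH ?rpredX.
Qed.

(** Over [K] the determinant of [Q(C)] splits into the values of [f] at the conjugates of [x], up to
    signs that the normalisation cancels; their product is the norm of [f(x)]. *)
Lemma residue_char_conj (K : finFieldType) (iota : {rmorphism F -> K}) i x Q :
  #|K| = (#|F| ^ i)%N -> Q \is monic -> map_poly iota Q = conj_poly F i x ->
  quad_char (map_poly iota f).[x] = residue_char Q.
Proof.
move=> cardK mQ QE; apply: (quad_char_norm (iota := iota) oddF cardK).
have [phi phiE] := frobenius_rmorphism iota.
have fX t : (map_poly iota f).[x] ^+ (#|F| ^ t) = (map_poly iota f).[x ^+ (#|F| ^ t)].
  elim: t => [|t IH]; first by rewrite expn0 !expr1.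
  rewrite expnSr exprM IH -phiE -horner_map /= phiE -exprM; congr horner.
  by apply/polyP => j; rewrite !coef_map /= phiE -rmorphXn /= expf_card.
under eq_bigr do rewrite fX.
rewrite rmorphM !rmorphXn /= rmorphN rmorph1 -det_map_mx map_horner_mx QE.
rewrite rmorph_prod /=.
rewrite -[size Q](size_map_poly iota) QE size_conj_poly /=.
have -> : \det (\prod_(t < i) horner_mx (map_mx iota C) ('X - (x ^+ (#|F| ^ t))%:P)) =
   \prod_(t < i) ((-1) ^+ N * (map_poly iota f).[x ^+ (#|F| ^ t)]).
  rewrite (big_morph (fun M : 'M[K]_N => \det M) (id1 := 1) (op1 := *%R)) ?det1 //; last first.
    by move=> A B; rewrite -mulmxE det_mulmx.
  apply: eq_bigr => t _; rewrite rmorphB /= horner_mx_X horner_mx_C.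
  by rewrite det_sub_scalar map_char_poly.
rewrite big_split /= prodr_const card_ord mulrA -expr2 -exprM mulnC exprM.
by rewrite -[X in X ^+ i](exprM (-1)) muln2 -signr_odd odd_double expr0 expr1n mul1r.
Qed.

Lemma sum_quad_char_extension (K : finFieldType) (iota : {rmorphism F -> K}) i :
  #|K| = (#|F| ^ i)%N ->
  \sum_(x : K) quad_char (map_poly iota f).[x] = prime_power_sum residue_char i.
Proof.
move=> cardK; apply: (sum_extension (iota := iota) cardK).
  by move=> P m; exact: residue_charX.
by move=> x Q mQ QE; exact: residue_char_conj cardK mQ QE.
Qed.

(* For a nonsquare [e] the map [h |-> e h + (1 - e) X^(n-N) f] permutes the monic polynomials
   of degree [n] and changes the sign of the character, since [f(C) = 0] and [N] is odd. *)
Lemma monic_sum_residue_char n : odd N -> (N <= n)%N -> monic_sum residue_char n = 0.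
Proof.
move=> oddN Nn; have [e etae] := exists_nonsquare oddF.
have e0 : e != 0 by rewrite -(quad_char_eq0 e) etae.
have gM : 'X^(n - N) * f \in monics F n.
  rewrite mem_monics rpredM ?monicXn ?char_poly_monic //.
  rewrite size_Mmonic ?monic_neq0 ?monicXn ?char_poly_monic //.
  by rewrite size_polyXn size_char_poly; apply/eqP; move: Nn; lia.
set g := 'X^(n - N) * f in gM.
pose phi (h : {poly F}) : {poly F} := e *: h + (1 - e) *: g.
have phiM h : h \in monics F n -> phi h \in monics F n.
  move=> /mapP[u _ ->]; have /mapP[v _ gE] := gM; apply/mapP.
  exists (e *: u + (1 - e) *: v); rewrite ?mem_enum // /phi gE.
  have -> : rVpoly (e *: u + (1 - e) *: v) = e *: rVpoly u + (1 - e) *: rVpoly v.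
    by rewrite linearP linearZ.
  by rewrite !scalerDr addrACA -scalerDl subrKC scale1r.
have inj_phi : injective phi.
  by move=> x y /addIr /(scalerI e0).
have perm : perm_eq [seq phi h | h <- monics F n] (monics F n).
  have un : uniq [seq phi h | h <- monics F n].
    by rewrite (map_inj_uniq inj_phi); exact: monics_uniq.
  have sub : {subset [seq phi h | h <- monics F n] <= monics F n}.
    by move=> _ /mapP[h hn ->]; exact: phiM.
  apply: uniq_perm => //; first exact: monics_uniq.
  exact: (uniq_min_size un sub (eq_leq (esym (size_map _ _)))).2.
have: monic_sum residue_char n = - monic_sum residue_char n.
  rewrite {1}/monic_sum -(perm_big _ perm) big_map -sumrN.
  rewrite big_seq [RHS]big_seq; apply: eq_bigr => h hn.
  have := phiM h hn; move: hn; rewrite !mem_monics => /andP[_ /eqP sh] /andP[_ /eqP sp].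
  rewrite /residue_char sh sp /phi linearD !linearZ /= rmorphM /= Cayley_Hamilton.
  rewrite mulr0 scaler0 addr0 detZ mulrCA quad_charM // quad_charX // etae.
  have -> : (-1 : int) ^+ N = -1 by rewrite -signr_odd oddN.
  by rewrite mulN1r.
lia.
Qed.

Lemma monic_sum0 (chi : {poly F} -> int) : chi 1 = 1 -> monic_sum chi 0 = 1.
Proof. by rewrite /monic_sum monics0 big_seq1. Qed.

End ResidueCharacter.

Lemma det_mx3 (R : comNzRingType) (m : nat -> nat -> R) :
  \det (\matrix_(i < 3, j < 3) m i j) =
    m 0 0 * (m 1 1 * m 2 2 - m 1 2 * m 2 1)
  - m 0 1 * (m 1 0 * m 2 2 - m 1 2 * m 2 0)
  + m 0 2 * (m 1 0 * m 2 1 - m 1 1 * m 2 0).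
Proof.
rewrite (expand_det_row _ ord0) !big_ord_recl big_ord0 addr0.
rewrite /cofactor !(expand_det_row _ ord0) !big_ord_recl !big_ord0 /cofactor !det_mx11.
rewrite !mxE /= /bump /= !(addn0, add0n, addn1, add1n).
by ring.
Qed.

(** * The companion matrix of the cubic, and the coefficients of its L-function *)

Section CubicCompanion.
Variables (F : finFieldType) (a b : F).

Definition cubic_entry (i j : nat) : F :=
  if j == i.+1 then 1 else if i != 2 then 0 else
  if j == 0%N then - b else if j == 1%N then - a else 0.

Definition cubic_companion : 'M[F]_3 := \matrix_(i < 3, j < 3) cubic_entry i j.

Definition cubic : {poly F} := 'X^3 + a%:P * 'X + b%:P.

Lemma char_poly_cubic_companion : char_poly cubic_companion = cubic.
Proof.
rewrite /char_poly /char_poly_mx.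
have -> : 'X%:M - map_mx polyC cubic_companion =
    \matrix_(i < 3, j < 3) ('X *+ (i == j :> nat) - (cubic_entry i j)%:P).
  by apply/matrixP => i j; rewrite !mxE.
rewrite (det_mx3 (fun i j => 'X *+ (i == j) - (cubic_entry i j)%:P)) /cubic_entry /=.
by rewrite /cubic !rmorphN /= !mulr1n !mulr0n; ring.
Qed.

Lemma det_quadratic_companion (u v : F) :
  \det (horner_mx cubic_companion ('X^2 + u%:P * 'X + v%:P)) =
  (b + u * v) ^+ 2 - u * (b + u * v) * (a - v + u ^+ 2) + v * (a - v + u ^+ 2) ^+ 2.
Proof.
(* The entries of the square of the companion matrix. *)
pose sq (i j : nat) := if i == 0%N then (if j == 2 then 1 else 0) else
  if i == 1%N then cubic_entry 2 j else
  if j == 0%N then 0 else if j == 1%N then - b else - a.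
have -> : horner_mx cubic_companion ('X^2 + u%:P * 'X + v%:P) =
    \matrix_(i < 3, j < 3) (sq i j + u * cubic_entry i j + v *+ (i == j :> nat)).
  rewrite !rmorphD !rmorphM /= horner_mx_X !horner_mx_C -!mulmxE mul_scalar_mx.
  apply/matrixP => i j; rewrite !mxE !big_ord_recl big_ord0 !mxE.
  by case: i => [[|[|[|//]]] ?]; case: j => [[|[|[|//]]] ?]; rewrite /sq /cubic_entry /=; ring.
rewrite (det_mx3 (fun i j => sq i j + u * cubic_entry i j + v *+ (i == j))).
by rewrite /sq /cubic_entry /=; ring.
Qed.

Hypothesis oddF : odd #|F|.
Local Notation chi := (residue_char cubic_companion).
Local Notation eta := (@quad_char F).

Lemma perm_monics2 : perm_eq (monics F 2)
  [seq 'X^2 + z.1%:P * 'X + z.2%:P | z : F * F].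
Proof.
apply: uniq_perm; first exact: monics_uniq.
  rewrite map_inj_uniq ?enum_uniq // => -[u v] [u' v'] /= E.
  have := congr1 (fun P : {poly F} => P`_1) E; have := congr1 (fun P : {poly F} => P`_0) E.
  by rewrite !coefD !coefXn !coefMX !coefC /= !add0r !addr0 => -> ->.
move=> h; rewrite mem_monics; apply/andP/imageP => [[mh /eqP szh]|[[u v] _ ->] /=].
  exists (h`_1, h`_0) => //=; apply/polyP => j.
  rewrite !coefD coefXn coefMX !coefC; case: j => [|[|[|j]]] /=; rewrite ?add0r ?addr0 ?coefC //=.
    by move/monicP: mh; rewrite lead_coefE szh /= => ->.
  by rewrite nth_default ?szh.
have sz : (size (u%:P * 'X + v%:P)%R < size ('X^2 : {poly F}))%N.
  rewrite size_polyXn ltnS; apply/leq_sizeP => -[|[|j]] // _.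
  by rewrite coefD coefMX !coefC /= addr0.
by rewrite -addrA size_polyDl // size_polyXn monicE lead_coefDl // lead_coefXn.
Qed.

Hypothesis disc : 4%:R * a ^+ 3 + 27%:R * b ^+ 2 != 0.
Local Notation f x := (x ^+ 3 + a * x + b).

(* With [v = a + u^2 - w] the determinant is [- w^3 f(u - f(u)/w) / f(u)] when [f(u)] and [w] are
   nonzero, so [s = - f(u)/w] matches the two sums up to squares. When [f(u) = 0] both sides are
   evaluated; this is where the discriminant enters. *)
Lemma sum_residue_char_quadratic (u : F) :
  \sum_(v : F) chi ('X^2 + u%:P * 'X + v%:P) = 1 + \sum_(s : F) eta s * eta (f (u + s)).
Proof.
(* The derivative of the cubic at [u], so that [f (u + s) = f u + c s + 3 u s^2 + s^3]. *)
pose c := 3%:R * u ^+ 2 + a.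
pose R w := f u ^+ 2 - 3%:R * u * f u * w + c * w ^+ 2 - w ^+ 3.
have -> : \sum_(v : F) chi ('X^2 + u%:P * 'X + v%:P) = \sum_(w : F) eta (R w).
  rewrite (reindex_inj (subrI (a + u ^+ 2))) /=; apply: eq_bigr => w _.
  have sz : size ('X^2 + u%:P * 'X + (a + u ^+ 2 - w)%:P) = 3.
    have : 'X^2 + u%:P * 'X + (a + u ^+ 2 - w)%:P \in monics F 2.
      by rewrite (perm_mem perm_monics2); apply/imageP; exists (u, a + u ^+ 2 - w).
    by rewrite mem_monics => /andP[_ /eqP].
  rewrite /residue_char sz det_quadratic_companion; congr quad_char.
  by rewrite /R /c; ring.
under [in RHS]eq_bigr do rewrite -quad_charM //.
have [fu0|fu_neq0] := eqVneq (f u) 0.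
  (* Here [f (u + s) = s (s^2 + 3 u s + c)]. A double root of the quadratic factor would give
     [4 a = - 3 u^2] and kill the discriminant, which is checked after multiplying by 16. *)
  have D : (3%:R * u) ^+ 2 != 4%:R * c.
    apply: contraNneq disc => E; have two := two_neq0 oddF.
    have b_eq : b = - (u ^+ 3 + a * u) by apply/eqP; rewrite -addr_eq0 addrC fu0.
    have a_eq : 4%:R * a = - (3%:R * u ^+ 2).
      apply/eqP; rewrite -subr_eq0; apply/eqP.
      transitivity (4%:R * c - (3%:R * u) ^+ 2); first by rewrite /c; ring.
      by rewrite E subrr.
    have four : (2%:R ^+ 4 : F) != 0 by rewrite expf_neq0.
    apply/eqP; apply: (mulfI four); rewrite mulr0 b_eq.
    transitivity ((4%:R * a) ^+ 3 + 27%:R * (4%:R * u ^+ 3 + (4%:R * a) * u) ^+ 2); first by ring.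
    by rewrite a_eq; ring.
  have sum_s := sum_quad_char_quadratic oddF D.
  have sum_w : \sum_(w : F) eta (c - w) = 0.
    by rewrite -[RHS](sum_quad_char oddF) [RHS](reindex_inj (subrI c)).
  rewrite (bigD1 0) //= [in RHS](bigD1 0) //= mul0r quad_char0.
  have -> : R 0 = 0 by rewrite /R fu0; ring.
  rewrite quad_char0 !add0r.
  have -> : \sum_(w | w != 0) eta (R w) = \sum_(w | w != 0) eta (c - w).
    apply: eq_bigr => w w0; rewrite -[RHS]mul1r -(quad_char_sqr oddF w0) -quad_charM //.
    by congr quad_char; rewrite /R fu0; ring.
  have -> : \sum_(s | s != 0) eta (s * f (u + s)) =
      \sum_(s | s != 0) eta (s ^+ 2 + 3%:R * u * s + c).
    apply: eq_bigr => s s0; rewrite -[RHS]mul1r -(quad_char_sqr oddF s0) -quad_charM //.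
    congr quad_char; transitivity (s * f u + s ^+ 2 * (s ^+ 2 + 3%:R * u * s + c)).
      by rewrite /c; ring.
    by rewrite fu0; ring.
  (* Both sums lack the same term [eta c] at 0; the complete sums are -1 and 0, which accounts for
     the 1 in the claim. *)
  move: sum_s sum_w; rewrite (bigD1 0) //= [X in _ -> X = _ -> _](bigD1 0) //=.
  rewrite expr0n mulr0 /= !add0r subr0 => E1 E2.
  by apply: (addrI (eta c)); rewrite addrCA E1 E2.
(* Because the inverse of 0 is 0, the substitution permutes [F] and matches [w = 0] with [s = 0];
   the term [eta (R 0)] supplies the 1. *)
have inj : injective (fun w : F => - f u * w^-1).
  by move=> x y /(mulfI _)/invr_inj; rewrite oppr_eq0 => ->.
rewrite [in RHS](reindex_inj inj) /= (bigD1 0) //= [in RHS](bigD1 0) //=.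
rewrite invr0 mulr0 mul0r quad_char0 add0r.
have -> : R 0 = f u ^+ 2 by rewrite /R; ring.
rewrite quad_char_sqr //; congr (_ + _); apply: eq_bigr => w w0.
have fw0 : f u / w ^+ 2 != 0 by rewrite mulf_neq0 ?invr_eq0 ?expf_neq0.
rewrite -[LHS]mulr1 -(quad_char_sqr oddF fw0).
rewrite -quad_charM //; congr quad_char; rewrite /R /c; field.
exact: w0.
Qed.

(** Summing the 1 over [u] gives [#|F|]. In the rest the sum over [u] is independent of the shift
    [s], so the vanishing sum of [eta s] factors out. *)
Lemma monic_sum_residue_char2 : monic_sum chi 2 = #|F|%:Z.
Proof.
rewrite /monic_sum (perm_big _ perm_monics2) big_image /=.
rewrite -(pair_bigA _ (fun u v : F => chi ('X^2 + u%:P * 'X + v%:P))) /=.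
under eq_bigr do rewrite sum_residue_char_quadratic.
rewrite big_split /= sumr_const natz exchange_big /=.
rewrite (eq_bigr (fun s => eta s * \sum_(x : F) eta (f x))) => [|s _].
  by rewrite -big_distrl /= sum_quad_char // mul0r addr0.
by rewrite -big_distrr [in RHS](reindex_inj (addIr s)).
Qed.

Lemma prime_power_sum_trace n : (0 < n)%N ->
  prime_power_sum chi n = - trace_seq (- prime_power_sum chi 1) #|F|%:Z n.
Proof.
have newton m := monic_sum_newton m (residue_char1 cubic_companion)
  (@residue_charM _ _ cubic_companion oddF).
have c0 : monic_sum chi 0 = 1 := monic_sum0 (residue_char1 _).
have c2 := monic_sum_residue_char2.
have c3 m : (3 <= m)%N -> monic_sum chi m = 0 by exact: monic_sum_residue_char.
have c1 : monic_sum chi 1 = prime_power_sum chi 1.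
  by have := newton 1%N; rewrite big_nat1 subnn c0 mul1r mulr1.
set S := prime_power_sum chi in c1 newton *.
have S2 : S 2 = 2 * #|F|%:Z - S 1%N ^+ 2.
  have := newton 2; rewrite c2 big_nat_recr //= big_nat1 subnn c0 mulr1 c1 -expr2 => ->.
  by rewrite addrAC subrr add0r.
(* From degree 3 on, the left side of Newton's identity vanishes and only the terms with [c_0],
   [c_1], [c_2] survive on the right. *)
have Srec m : S m.+3 = - S 1%N * S m.+2 - #|F|%:Z * S m.+1.
  have := newton m.+3; rewrite c3 // mulr0 big_nat_recr //= big_nat_recr //= big_nat_recr //=.
  rewrite subnn c0 subSnn c1 (_ : (m.+3 - m.+1 = 2)%N) ?c2; last by lia.
  rewrite big_nat_cond big1 ?add0r => [|j /andP[/andP[_ jm] _]]; last first.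
    by rewrite c3 ?mulr0 //; lia.
  move=> E; rewrite -[LHS]subr0 E; ring.
elim/ltn_ind: n => -[|[|[|n]]] // IH _.
- by rewrite /= opprK.
- by rewrite S2 /=; ring.
by rewrite Srec (IH n.+2) // (IH n.+1) //=; ring.
Qed.

End CubicCompanion.

(** * Stepanov's method *)

Lemma poly_linear_dependence (K : fieldType) (I : finType) (B : I -> {poly K}) (d : nat) :
  (forall i, size (B i) <= d)%N -> (d < #|I|)%N ->
  exists2 lam : I -> K, (exists i, lam i != 0) & \sum_i lam i *: B i = 0.
Proof.
move=> szB ltd; pose M := \matrix_(k < #|I|, j < d) (B (enum_val k))`_j.
have ker0 : kermx M != 0.
  rewrite kermx_eq0 /row_free; apply/eqP => rk.
  by have := rank_leq_col M; rewrite rk leqNgt ltd.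
case/rowV0Pn: ker0 => v /sub_kermxP vM v0.
have [k' vk'] : exists k', v 0 k' != 0.
  case: (pickP (fun k' => v 0 k' != 0)) => [k' ?|none]; first by exists k'.
  by move/eqP: v0; case; apply/rowP => j; rewrite mxE; apply/eqP/negbFE/none.
exists (fun i => v 0 (enum_rank i)).
  by exists (enum_val k'); rewrite enum_valK.
rewrite (reindex (@enum_val I predT)) /=; last first.
  by apply: onW_bij; exists enum_rank; [exact: enum_valK|exact: enum_rankK].
apply/polyP => j; rewrite coef0 coef_sum; under eq_bigr do rewrite enum_valK coefZ.
have [jd|dj] := ltnP j d.
  have := congr1 (fun A : 'rV[K]_d => A 0 (Ordinal jd)) vM; rewrite !mxE => E; rewrite -[RHS]E.
  by apply: eq_bigr => i _; rewrite mxE.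
by rewrite big1 // => i _; rewrite nth_default ?mulr0 // (leq_trans (szB _)).
Qed.

(** The leading term of the largest [G i] with nonzero coefficient cannot be cancelled. *)
Lemma poly_distinct_sizes_free (K : fieldType) (I : finType) (G : I -> {poly K}) (lam : I -> K) :
  (forall i, G i != 0) -> injective (fun i => size (G i)) -> (exists i, lam i != 0) ->
  \sum_i lam i *: G i != 0.
Proof.
move=> G0 injG [i0 li0].
case: (arg_maxnP (fun i => size (G i)) (P := fun i => lam i != 0) li0) => i li maxi.
apply/eqP => sum0; have := congr1 (fun P : {poly K} => P`_(size (G i)).-1) sum0.
rewrite coef0 coef_sum (bigD1 i) //= big1 ?addr0 => [|j ji].
  by rewrite coefZ => /eqP; rewrite mulf_eq0 (negPf li) -lead_coefE lead_coef_eq0 (negPf (G0 i)).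
rewrite coefZ; have [->|lj] := eqVneq (lam j) 0; first by rewrite mul0r.
rewrite nth_default ?mulr0 // -ltnS prednK ?size_poly_gt0 //.
have /= le := maxi j lj.
rewrite ltn_neqAle le andbT; apply: contra_neq ji; exact: injG.
Qed.

Section Stepanov.
Variables (K : finFieldType) (r : nat) (f : {poly K}).
Local Notation q0 := (r.*2.+1).
Hypotheses (r_ge8 : (8 <= r)%N) (cardK : #|K| = (q0 ^ 2)%N).
Hypothesis pnat_q0 : [pchar K].-nat q0.
Hypothesis size_f : size f = 4%N.

Lemma exp_q0_sum (I : finType) (g : I -> K) : (\sum_i g i) ^+ q0 = \sum_i g i ^+ q0.
Proof.
apply: (big_morph (fun x : K => x ^+ q0)); last by rewrite expr0n.
by move=> x y; exact: exprDn_pchar.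
Qed.

(* At a point [x] with [f(x)^((q0^2 - 1)/2) = c], the [q0]-th power of [unreduced t] takes the
   same value as [reduced c t], because [x^(q0^2) = x]; the reduced polynomials have degrees so
   small that they are linearly dependent. *)
Let idx := (bool * 'I_r.-1 * 'I_r.+2)%type.
Let reduced (c : K) (t : idx) : {poly K} := 'X^(t.1.2 * q0 + t.2) * (c%:P * f ^+ r.+1) ^+ t.1.1.
Let unreduced (t : idx) : {poly K} := 'X^(t.1.2 + t.2 * q0) * (f ^+ r.+1) ^+ t.1.1.

Lemma base_neq0 : f != 0. Proof. by rewrite -size_poly_eq0 size_f. Qed.

Lemma size_base_exp n : size (f ^+ n) = (3 * n).+1.
Proof.
have := size_exp f n; rewrite size_f /= => <-.
by rewrite prednK // size_poly_gt0 expf_neq0 ?base_neq0.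
Qed.

Lemma size_reduced_le c t : (size (reduced c t) <= 2 * r ^ 2 + r + 3)%N.
Proof.
case: t => [[e i] j]; rewrite /reduced /=; have := ltn_ord i; have := ltn_ord j => jlt ilt.
apply: leq_trans (size_polyMleq _ _) _; rewrite size_polyXn /=.
have : (size ((c%:P * f ^+ r.+1) ^+ e) <= (3 * r.+1).+1)%N.
  case: e => /=; last by rewrite expr0 size_poly1.
  rewrite expr1; apply: leq_trans (size_polyMleq _ _) _; rewrite size_base_exp.
  by have := size_polyC_leq1 c; lia.
move: (size _) => s sle.
have : (i * q0 + j <= (r - 2) * q0 + r.+1)%N.
  by rewrite leq_add // leq_mul2r; apply/orP; right; lia.
nia.
Qed.

Lemma size_unreduced t : size (unreduced t) = (t.1.2 + t.2 * q0 + 3 * r.+1 * t.1.1).+1.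
Proof.
rewrite /unreduced -exprM size_monicM ?monicXn ?expf_neq0 ?base_neq0 //.
by rewrite size_polyXn size_base_exp mulnA addSn addnS.
Qed.

Lemma unreduced_neq0 t : unreduced t != 0.
Proof. by rewrite -size_poly_eq0 size_unreduced. Qed.

(* Twice the degree is [(2i + 3e) + (2j + 3e) q0], so its base-[q0] digits give [e], [i], [j]. *)
Lemma size_unreduced_inj : injective (fun t => size (unreduced t)).
Proof.
move=> [[e i] j] [[e' i'] j']; rewrite !size_unreduced /= => -[E].
have ei := ltn_ord i; have ei' := ltn_ord i'.
have E2 : ((2 * j + 3 * e) * q0 + (2 * i + 3 * e) = (2 * j' + 3 * e') * q0 + (2 * i' + 3 * e'))%N.
  by nia.
have lt1 : (2 * i + 3 * e < q0)%N by case: (e); lia.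
have lt2 : (2 * i' + 3 * e' < q0)%N by case: (e'); lia.
have := congr1 (modn^~ q0) E2; rewrite !modnMDl !modn_small // => E3.
have E4 : (2 * j + 3 * e = 2 * j' + 3 * e')%N by nia.
have ee : e = e' by case: e e' E3 {E E2 lt1 lt2 E4} => [] []; lia.
move: E3 E4; rewrite ee => /addIn E3 /addIn E4.
by congr (_, _, _); apply: val_inj => /=; lia.
Qed.

Lemma card_char_level_le (c : K) :
  (#|[set x | f.[x] ^+ #|K|./2 == c]| <= 2 * r ^ 2 + 7 * r + 2)%N.
Proof.
have cardI : #|{: idx}| = (2 * r.-1 * r.+2)%N by rewrite !card_prod card_bool !card_ord.
(* The family has [2 r^2 + 2 r - 4] members, so the inequality amounts to [r >= 8]. *)
have lt : (2 * r ^ 2 + r + 3 < #|{: idx}|)%N by rewrite cardI; nia.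
have [lam [t0 lt0] lam0] := poly_linear_dependence (size_reduced_le c) lt.
(* The [q0]-th power of [h(x)] has coefficients [lam t ^ (q0^2) = lam t], so on the level set it
   becomes the vanishing combination of the [reduced] polynomials. *)
pose h := \sum_t (lam t ^+ q0) *: unreduced t.
have h0 : h != 0.
  apply: poly_distinct_sizes_free unreduced_neq0 size_unreduced_inj _.
  by exists t0; rewrite expf_neq0.
have szh : (size h <= 2 * r ^ 2 + 7 * r + 3)%N.
  apply: (leq_trans (size_sum _ _ _)); apply/bigmax_leqP => -[[e i] j] _.
  apply: leq_trans (size_scale_leq _ _) _; rewrite size_unreduced /=.
  have := ltn_ord i; have := ltn_ord j; move: (nat_of_ord i) (nat_of_ord j) => {}i {}j jlt ilt.
  have : (j * q0 <= r.+1 * q0)%N by rewrite leq_mul2r orbC -ltnS jlt.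
  by case: (e); nia.
have half : (#|K|./2 = 2 * r ^ 2 + 2 * r)%N.
  by rewrite cardK; lia.
rewrite -ltnS -[X in (_ < X)%N]addn1 -addnA; apply: leq_trans szh.
rewrite cardE; apply: max_poly_roots h0 _ (enum_uniq _).
apply/allP => x; rewrite mem_enum inE => /eqP fx.
have: (h.[x]) ^+ q0 == 0; last by rewrite expf_eq0.
rewrite /h horner_sum exp_q0_sum.
have := congr1 (fun P : {poly K} => P.[x]) lam0; rewrite horner0 horner_sum => E.
apply/eqP; rewrite -[RHS]E; apply: eq_bigr => -[[e i] j] _; rewrite !hornerZ exprMn -exprM.
have xq (y : K) : y ^+ (q0 * q0) = y by rewrite mulnn -cardK expf_card.
rewrite xq; congr (_ * _); rewrite /unreduced /reduced /= !hornerE.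
rewrite exprMn; congr (_ * _).
  by rewrite -exprM mulnDl exprD -mulnA (exprM x j) xq exprD.
rewrite (exprAC (f.[x] ^+ r.+1)); congr (_ ^+ _).
(* The total exponent is [(r + 1) q0]. *)
have -> : c * f.[x] ^+ r.+1 = f.[x] ^+ (2 * r ^ 2 + 2 * r + r.+1) by rewrite exprD -half fx.
by rewrite -exprM; congr (_ ^+ _); nia.
Qed.

(** The three levels fill [K] and the zero level has at most 3 points, so an upper bound for one
    sign bounds the other from below. The difference is at most [10 r + 6], which is below
    [6 q0]. *)
Lemma sum_quad_char_poly_le : `|\sum_(x : K) quad_char f.[x]| <= 6 * q0%:Z.
Proof.
have oddK : odd #|K| by rewrite cardK oddX /= odd_double.
pose M (e : int) := #|[set x | f.[x] ^+ #|K|./2 == e%:~R]|.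
have etaE x e : e \in [:: 0; 1; -1] -> (quad_char f.[x] == e) = (f.[x] ^+ #|K|./2 == e%:~R).
  move=> He; rewrite -quad_char_euler //; apply/eqP/eqP => [->//|E].
  apply: quad_char_unique => //; last by rewrite -quad_char_euler.
  by move: He; rewrite !inE => /or3P[] /eqP ->; [constructor 1|constructor 2|constructor 3].
have M0 : (M 0%R <= 3)%N.
  rewrite -ltnS -size_f /M cardE; apply: max_poly_roots base_neq0 _ (enum_uniq _).
  by apply/allP => x; rewrite mem_enum inE mulr0z expf_eq0 => /andP[].
have ME e : e \in [:: 0; 1; -1] -> M e = (\sum_x (quad_char f.[x] == e))%N.
  move=> He; rewrite /M -sum1_card big_mkcond; apply: eq_bigr => x _.
  by rewrite inE -etaE //; case: eqP.
have Msum : (M 0%R + M 1%R + M (-1)%R = #|K|)%N.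
  rewrite !ME // -!big_split -sum1_card; apply: eq_bigr => x _ /=.
  by case: (quad_char_cases f.[x]) => ->.
have Mdiff : \sum_(x : K) quad_char f.[x] = (M 1)%:Z - (M (-1))%:Z.
  rewrite !ME // -!natz !natr_sum -sumrB; apply: eq_bigr => x _.
  by case: (quad_char_cases f.[x]) => ->.
have M1 : (M 1%R <= 2 * r ^ 2 + 7 * r + 2)%N := card_char_level_le _.
have M2 : (M (-1)%R <= 2 * r ^ 2 + 7 * r + 2)%N := card_char_level_le _.
rewrite Mdiff ler_norml; rewrite cardK in Msum; apply/andP; split; nia.
Qed.

End Stepanov.

(** * The trace sequence *)

Section TraceSequence.
Variables a q : int.
Local Notation s := (trace_seq a q).

Lemma trace_seqSS n : s n.+2 = a * s n.+1 - q * s n. Proof. by []. Qed.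

(** With [s n] the sum of the [n]-th powers of the roots of [X^2 - a X + q], this expands
    [s j * s (n + j)]. The roots are avoided by induction on two consecutive [j]. *)
Lemma trace_seq_add2 n j : s (n + j.*2) = s j * s (n + j) - q ^+ j * s n.
Proof.
suff: (forall n, s (n + j.*2) = s j * s (n + j) - q ^+ j * s n) /\
      forall n, s (n + j.+1.*2) = s j.+1 * s (n + j.+1) - q ^+ j.+1 * s n by case.
elim: j {n} => [|j [IH0 IH1]].
  split=> n; first by rewrite /= addn0; ring.
  by rewrite addn2 addn1 trace_seqSS expr1 /=.
split=> // n; have E1 := IH1 n.+1; have E0 := IH0 n.+2.
rewrite !doubleS !addnS !addSn in E0 E1 *.
rewrite trace_seqSS E1 E0 !trace_seqSS !exprS.
move: (s _) (s _) (s _) (s _) (s _) (s _) (q ^+ j) => *; ring.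
Qed.

Lemma trace_seq_double j : s j.*2 = s j ^+ 2 - 2 * q ^+ j.
Proof. by have := trace_seq_add2 0 j; rewrite !add0n => ->; rewrite /=; ring. Qed.

(* If [s k ^ 2 > 4 q ^ k], the ratio [s (2 m) / q ^ m - 2] is positive at [m = k] and at least
   quadruples each time [m] is doubled. *)
Lemma trace_seq_sqr_le k : 0 < q -> (0 < k)%N ->
  (forall m, (0 < m)%N -> s m.*2 <= 6 * q ^+ m) -> s k ^+ 2 <= 4 * q ^+ k.
Proof.
move=> q0 k0 bound; rewrite leNgt; apply/negP => gt.
pose Q := q ^+ k; have Q0 : 0 < Q by rewrite exprn_gt0.
have grow t : 4 ^+ t * q ^+ (k * 2 ^ t) <= Q * (s (k * 2 ^ t).*2 - 2 * q ^+ (k * 2 ^ t)).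
  elim: t => [|t].
    rewrite expn0 muln1 expr0 mul1r trace_seq_double.
    rewrite -[leLHS]mulr1 ler_pM2l //; move: gt; rewrite -/Q; lia.
  rewrite expnSr mulnA muln2 (trace_seq_double (k * 2 ^ t).*2).
  have -> : q ^+ (k * 2 ^ t).*2 = q ^+ (k * 2 ^ t) * q ^+ (k * 2 ^ t) by rewrite -exprD addnn.
  rewrite exprSr; have : 0 < q ^+ (k * 2 ^ t) by rewrite exprn_gt0.
  have : 0 < (4 : int) ^+ t by rewrite exprn_gt0.
  move: (s _) (q ^+ _) (4 ^+ t) => w z c c0 z0 IH.
  have w0 : 0 < w - 2 * z.
    by rewrite -(pmulr_rgt0 _ Q0); apply: (lt_le_trans _ IH); rewrite mulr_gt0.
  (* Since [w > 2 z], the second factor exceeds [4 z]: this is the quadrupling. *)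
  have -> : w ^+ 2 - 2 * (z * z) - 2 * (z * z) = (w - 2 * z) * (w + 2 * z) by ring.
  have -> : c * 4 * (z * z) = (c * z) * (4 * z) by ring.
  rewrite [leRHS]mulrA; apply: ler_pM => //; [exact: mulr_ge0 (ltW c0) (ltW z0) | lia | lia].
(* The assumed bound limits the right side of [grow] to [4 Q z], so [4^(t-1) <= Q]; this [t]
   contradicts [Q < 4^Q]. *)
have := grow (`|Q|%N).+1; set t := (`|Q|%N).+1.
have := bound (k * 2 ^ t)%N; rewrite muln_gt0 k0 expn_gt0 /= => /(_ isT).
have : 0 < q ^+ (k * 2 ^ t) by rewrite exprn_gt0.
move: (s _) (q ^+ (k * _)) => w z z0 le1 le2.
have: 4 ^+ t * z <= 4 * Q * z.
  by apply: le_trans le2 _; rewrite [4 * Q]mulrC -mulrA ler_pM2l //; lia.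
rewrite ler_pM2r // exprS ler_pM2l //.
have : (`|Q| < 4 ^ `|Q|)%N by apply: ltn_expl.
rewrite -ltz_nat gtz0_abs // -(natz (4 ^ _)) natrX => lt le.
by have := lt_le_trans lt le; rewrite ltxx.
Qed.

End TraceSequence.

(** * Reduction to the prime field *)

Lemma Posz_expn (n m : nat) : (n ^ m)%N%:Z = n%:Z ^+ m.
Proof. by rewrite -[LHS]natz natrX natz. Qed.

Definition prime_field_rmorphism (p : nat) (K : finFieldType) (charK : p \in [pchar K]) :
  {rmorphism 'F_p -> K} :=
  (GRing.in_alg (pPrimeCharType charK) : {rmorphism 'F_p -> pPrimeCharType charK}).

Lemma map_cubic_horner (F K : finFieldType) (iota : {rmorphism F -> K}) A B (x : K) :
  (map_poly iota (cubic A%:R B%:R)).[x] = x ^+ 3 + A%:R * x + B%:R.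
Proof.
rewrite /cubic !rmorphD /= map_polyXn rmorphM /= map_polyX !map_polyC /=.
by rewrite !hornerE /= !rmorph_nat.
Qed.

Section PrimeField.
Variables (p A B : nat).
Hypotheses (p_prime : prime p) (p_ge17 : (17 <= p)%N).
Local Notation a := (A%:R : 'F_p).
Local Notation b := (B%:R : 'F_p).
Local Notation char_sum K := (\sum_(x : K) quad_char (x ^+ 3 + A%:R * x + B%:R)).

Lemma odd_p : odd p.
Proof. by case/even_prime: p_prime p_ge17 => // ->. Qed.

Lemma odd_card_Fp : odd #|'F_p|.
Proof. by rewrite card_Fp // odd_p. Qed.

Lemma natr_Fp_eq0 n : (n%:R == 0 :> 'F_p) = (n %% p == 0)%N.
Proof. by rewrite -(dvdn_pcharf (pchar_Fp p_prime)). Qed.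

Lemma char_sum_extension (K : finFieldType) j : #|K| = (p ^ j)%N ->
  char_sum K = prime_power_sum (residue_char (cubic_companion a b)) j.
Proof.
move=> cardK; have charK := card_finPcharP cardK p_prime.
rewrite -(sum_quad_char_extension _ odd_card_Fp (prime_field_rmorphism charK)); last first.
  by rewrite cardK card_Fp.
by apply: eq_bigr => x _; rewrite char_poly_cubic_companion map_cubic_horner.
Qed.

Lemma char_sum_square_le (K : finFieldType) m : #|K| = (p ^ m.*2)%N -> (0 < m)%N ->
  `|char_sum K| <= 6 * p%:Z ^+ m.
Proof.
move=> cardK m0; pose r := (p ^ m)./2.
have oddq : odd (p ^ m) by rewrite oddX odd_p orbT.
have rE : (p ^ m = r.*2.+1)%N by rewrite -[LHS]odd_double_half oddq.
(* This is where [p >= 17] enters Stepanov's method: [2 r + 1 = p^m >= 17]. *)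
have r8 : (8 <= r)%N.
  have : (p ^ 1 <= p ^ m)%N by rewrite leq_exp2l // prime_gt1.
  by rewrite expn1; move: p_ge17 rE; lia.
have charK := card_finPcharP cardK p_prime.
have cardK2 : #|K| = (r.*2.+1 ^ 2)%N by rewrite cardK -rE -expnM muln2.
have pnat : [pchar K].-nat r.*2.+1 by rewrite -rE pnatX pnatE ?charK.
have szf : size (cubic (A%:R : K) B%:R) = 4%N.
  rewrite /cubic -addrA size_polyDl size_polyXn // ltnS; apply/leq_sizeP => -[|[|k]] // _.
  by rewrite coefD coefMX !coefC /= addr0.
have := sum_quad_char_poly_le r8 cardK2 pnat szf.
rewrite -rE Posz_expn.
by under eq_bigr do rewrite /cubic !hornerE.
Qed.

Lemma disc0_param : 4%:R * a ^+ 3 + 27%:R * b ^+ 2 = 0 ->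
  exists al : 'F_p, a = - 3%:R * al ^+ 2 /\ b = 2%:R * al ^+ 3.
Proof.
have nz n : (0 < n < 17)%N -> (n%:R : 'F_p) != 0.
  by move=> /andP[n0 n17]; rewrite natr_Fp_eq0 modn_small -?lt0n // (leq_trans n17).
have two := nz 2 isT; have f27 : (27%:R : 'F_p) != 0.
  by rewrite (natrM _ 3 9) mulf_neq0 // nz.
have [-> E|a0 E] := eqVneq a 0.
  exists 0; split; first by ring.
  move: E; rewrite expr0n mulr0 add0r => /eqP; rewrite mulf_eq0 (negPf f27) expf_eq0 /=.
  by move/eqP->; ring.
have E' : 27%:R * b ^+ 2 = - (4%:R * a ^+ 3) by apply/eqP; rewrite -addr_eq0 addrC E.
(* The double root of the cubic, found by solving [a = - 3 al^2], [b = 2 al^3] for [al]. *)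
exists (- (3%:R * b) / (2%:R * a)); split.
  transitivity (- (27%:R * b ^+ 2) / (4%:R * a ^+ 2)); last by field; rewrite a0 two (nz 4).
  by rewrite E'; field; rewrite a0 (nz 4).
transitivity (- (27%:R * b ^+ 2) * b / (4%:R * a ^+ 3)); last by field; rewrite a0 two (nz 4).
by rewrite E'; field; rewrite a0 (nz 4).
Qed.

Lemma char_sum_singular : 4%:R * a ^+ 3 + 27%:R * b ^+ 2 = 0 ->
  exists al : 'F_p, forall (K : finFieldType) j, #|K| = (p ^ j)%N ->
    char_sum K = - quad_char al ^+ j.
Proof.
case/disc0_param => al [aE bE]; exists (3%:R * al) => K j cardK.
have charK := card_finPcharP cardK p_prime.
have cardK' : #|K| = (#|'F_p| ^ j)%N by rewrite card_Fp.
have io := prime_field_rmorphism charK.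
rewrite -(quad_char_rmorph io _ odd_card_Fp cardK').
have oddK : odd #|K| by rewrite cardK' oddX odd_card_Fp orbT.
rewrite rmorphM /= rmorph_nat -(sum_quad_char_singular oddK); apply: eq_bigr => x _.
congr quad_char.
have -> : (A%:R : K) = - 3%:R * io al ^+ 2.
  by rewrite -(rmorph_nat io A) aE rmorphM rmorphN rmorph_nat rmorphXn.
have -> : (B%:R : K) = 2%:R * io al ^+ 3.
  by rewrite -(rmorph_nat io B) bE rmorphM rmorph_nat rmorphXn.
by ring.
Qed.

End PrimeField.

(* [F j] is an arbitrary model of the finite field with [p ^ j] elements. *)
Theorem theorem7 (R : realType) (p k A B : nat) (F : nat -> finFieldType)
    (p_prime : prime p) (p_ge17 : (17 <= p)%N) (k_ge1 : (1 <= k)%N)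
    (cardF : forall j : nat, (1 <= j)%N -> #|F j| = (p ^ j)%N) :
  let Abar : nat := (A %% p)%N in
  let Bbar : nat := (B %% p)%N in
  let N : nat -> nat := fun j => affine_count (F j) Abar Bbar in
  let a_p : int := p%:Z - (N 1%N)%:Z in
  let s : nat -> int := trace_seq a_p p%:Z in
  let disc : nat := (4 * Abar ^ 3 + 27 * Bbar ^ 2)%N in
  (disc <> 0 %[mod p] ->
     (N k)%:Z = p%:Z ^+ k - s k /\
     `|(s k)%:~R| <= 2 * (p%:R `^ (k%:R / 2)) :> R) /\
  (disc = 0 %[mod p] ->
     (N k)%:Z = p%:Z ^+ k - a_p ^+ k /\
     (a_p = 0 \/ a_p = 1 \/ a_p = -1)).
Proof.
move=> Abar Bbar N a_p s disc.
pose S j := \sum_(x : F j) quad_char (x ^+ 3 + Abar%:R * x + Bbar%:R).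
have NE j : (0 < j)%N -> (N j)%:Z = p%:Z ^+ j + S j.
  move=> j0; have oddK : odd #|F j| by rewrite cardF // oddX (odd_p p_prime p_ge17) orbT.
  by rewrite /N affine_count_quad_char // cardF // Posz_expn.
have a_pE : a_p = - S 1%N by rewrite /a_p NE // expr1 opprD addNKr.
have discE : (4%:R * Abar%:R ^+ 3 + 27%:R * Bbar%:R ^+ 2 == 0 :> 'F_p) = (disc %% p == 0)%N.
  by rewrite -(natr_Fp_eq0 p_prime) /disc natrD natrM natrX natrM natrX.
rewrite mod0n; split=> [/eqP|/eqP]; rewrite -discE.
  move=> disc_neq0.
  have SE j : (0 < j)%N -> S j = - s j.
    move=> j0; rewrite /S (char_sum_extension _ _ p_prime p_ge17 (cardF j j0)).
    rewrite (prime_power_sum_trace (odd_card_Fp p_prime p_ge17) disc_neq0) // card_Fp //.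
    by rewrite -(char_sum_extension _ _ p_prime p_ge17 (cardF 1%N isT)) -a_pE.
  split; first by rewrite NE // SE.
  (* The fields [F m.*2] of even degree supply the bound for every [m]; the estimate over the reals
     then follows by comparing squares. *)
  have s2 : s k ^+ 2 <= 4 * p%:Z ^+ k.
    apply: trace_seq_sqr_le => // [|m m0]; first by rewrite ltz_nat prime_gt0.
    have m20 : (0 < m.*2)%N by rewrite double_gt0.
    have := char_sum_square_le Abar Bbar p_prime p_ge17 (cardF _ m20) m0.
    by rewrite -/(S m.*2) SE // normrN; apply: le_trans; rewrite ler_norm.
  set y := _ `^ _; have y0 : 0 <= y by exact: powR_ge0.
  have y2 : y ^+ 2 = p%:R ^+ k.
    by rewrite -powR_mulrn // -powRrM -mulrA mulVf ?pnatr_eq0 // mulr1 powR_mulrn.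
  rewrite -ler_sqr ?nnegrE ?mulr_ge0 //.
  rewrite real_normK ?num_real // exprMn y2.
  move: s2; rewrite -(ler_int R) rmorphXn rmorphM rmorphXn /= => s2; apply: (le_trans s2).
  have four : (2 : R) ^+ 2 = 4 by rewrite -natrX.
  by rewrite rmorph_nat four.
move/eqP/(char_sum_singular p_prime p_ge17) => [al SE].
have {}SE j : (0 < j)%N -> S j = - quad_char al ^+ j by move=> j0; apply: SE; exact: cardF.
(* The case [j = 1] identifies [a_p] with a character value, which gives both the power formula and
   the three possible values. *)
have a_pal : a_p = quad_char al by rewrite a_pE SE // opprK expr1.
rewrite NE // SE // a_pal; split=> //.
by case: (quad_char_cases al) => ->; [left|right; left|right; right].
Qed.
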